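(* Let $\mathcal X$ be a subshift of $A^{\mathbb Z}$ and let $\mathsf V$ be a pseudovariety of semigroups containing $\mathcal{L}\mathsf{Sl}$. For every positive integer $n$, the number $q_{\mathcal X}(n)$ of periodic points of $\mathcal X$ with least period $n$ is equal to the number of objects of the category $\mathbb K(\mathcal M_{\mathsf V}(\mathcal X))$ whose isomorphism class (the set of objects isomorphic to it in this category) has cardinality $n$.
   Context: Alphabets are finite nonempty sets; $A^+$ is the free semigroup on $A$. A pseudovariety of semigroups is a class of finite semigroups closed under subsemigroups, homomorphic images and finite direct products. $\mathcal L\mathsf{Sl}$ is the class of finite semigroups $S$ such that $eSe$ is a semilattice (commutative, all elements idempotent) for every idempotent $e$ of $S$. $\widehat F_{\mathsf V}(A)$ is the free pro-$\mathsf V$ semigroup on $A$, i.e. the inverse limit of the finite quotients of $A^+$ belonging to $\mathsf V$; if $\mathsf V\supseteq\mathcal L\mathsf{Sl}$, $A^+$ embeds in it as a dense subsemigroup of isolated points. A subshift of $A^{\mathbb Z}$ is a nonempty closed set $\mathcal X\subseteq A^{\mathbb Z}$ with $\sigma(\mathcal X)=\mathcal X$, where $\sigma((x_i)_i)=(x_{i+1})_i$. $L(\mathcal X)\subseteq A^+$ is the set of nonempty finite words occurring in elements of $\mathcal X$. A point $x$ is periodic if $\sigma^n(x)=x$ for some $n\ge 1$, and the smallest such $n$ is its least period. The mirage $\mathcal M_{\mathsf V}(\mathcal X)$ is the set of $u\in\widehat F_{\mathsf V}(A)$ all of whose factors in $A^+$ belong to $L(\mathcal X)$. $\mathbb K(\mathcal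 M_{\mathsf V}(\mathcal X))$ is the category whose objects are the idempotents of $\widehat F_{\mathsf V}(A)$ belonging to $\mathcal M_{\mathsf V}(\mathcal X)$, whose arrows $f\to e$ are the triples $(e,u,f)$ with $u\in\mathcal M_{\mathsf V}(\mathcal X)$ and $u=euf$, with composition $(e,u,f)(f,v,g)=(e,uv,g)$ and identities $(e,e,e)$. *)

(* Defs.v *)
From HB Require Import structures.
From mathcomp Require Import all_boot all_algebra finmap.
From mathcomp Require Import all_classical.
From mathcomp Require Import topology.

Set Implicit Arguments.
Unset Strict Implicit.
Unset Printing Implicit Defensive.

Local Open Scope classical_set_scope.
Local Open Scope group_scope.
Local Open Scope quotient_scope.

#[short(type="finSemigroupType")]
HB.structure Definition FinSemigroup := {S of Semigroup S & Finite S}.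

Section DirectProduct.
Variables (I : finType) (S : I -> finSemigroupType).

Definition dffun_mul (x y : {dffun forall i, S i}) : {dffun forall i, S i} :=
  [ffun i => x i * y i].

Lemma dffun_mulA : associative dffun_mul.
Proof. by move=> x y z; apply/ffunP => i; rewrite !ffunE mulgA. Qed.

HB.instance Definition _ :=
  isSemigroup.Build {dffun forall i, S i} dffun_mulA.
End DirectProduct.

Record is_pseudovariety (V : finSemigroupType -> Prop) : Prop := {
  pv_sub : forall (S T : finSemigroupType) (f : {multiplicative T -> S}),
    injective f -> V S -> V T;
  pv_image : forall (S T : finSemigroupType) (f : {multiplicative S -> T}),
    (forall t, exists s, f s = t) -> V S -> V T;
  pv_prod : forall (I : finType) (S : I -> finSemigroupType),
    (forall i, V (S i)) -> V {dffun forall i, S i}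
}.

Definition is_idempotent (S : semigroupType) (e : S) : Prop := e * e = e.

Definition LSl (S : finSemigroupType) : Prop :=
  forall e : S, is_idempotent e ->
    let eSe := [set x | exists s : S, x = e * s * e] in
    (forall x y, eSe x -> eSe y -> x * y = y * x) /\
    (forall x, eSe x -> is_idempotent x).

(** [s] is a factor of [t] when [t] belongs to [S^1 s S^1]. *)
Definition is_factor (S : semigroupType) (s t : S) : Prop :=
  [\/ t = s, exists p, t = p * s, exists q, t = s * q
   | exists p q, t = p * s * q].

Record congruence (S : semigroupType) := Congruence {
  cong_rel :> equiv_rel S;
  congM : forall x x' y y', cong_rel x x' -> cong_rel y y' ->
    cong_rel (x * y) (x' * y')
}.

Section Quotient.
Variables (S : semigroupType) (theta : congruence S).

Definition cong_quotient : Type := {eq_quot (cong_rel theta)}.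

HB.instance Definition _ := Choice.on cong_quotient.
HB.instance Definition _ := EqQuotient.on cong_quotient.

Lemma pi_quotientP x y :
  reflect (\pi_cong_quotient x = \pi_cong_quotient y) (theta x y).
Proof. exact: (@eqquotP _ (cong_rel theta)). Qed.

Lemma cong_repr x : theta x (repr (\pi_cong_quotient x)).
Proof. by apply/pi_quotientP; rewrite reprK. Qed.

Definition quotient_mul (x y : cong_quotient) : cong_quotient :=
  \pi_cong_quotient (repr x * repr y).

Lemma pi_quotient_mul x y :
  \pi_cong_quotient (x * y) = quotient_mul (\pi_cong_quotient x) (\pi_cong_quotient y).
Proof. by apply: (elimT (pi_quotientP _ _)); apply: congM; apply: cong_repr. Qed.

Lemma quotient_mulA : associative quotient_mul.
Proof.
move=> x y z; rewrite -(reprK x) -(reprK y) -(reprK z).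
rewrite -(pi_quotient_mul (repr y) (repr z)) -(pi_quotient_mul (repr x)).
by rewrite mulgA (pi_quotient_mul (_ * _)) (pi_quotient_mul (repr x)).
Qed.

HB.instance Definition _ := isSemigroup.Build cong_quotient quotient_mulA.

Lemma pi_quotientM : {morph \pi_cong_quotient : x y / x * y}.
Proof. exact: pi_quotient_mul. Qed.
End Quotient.

Section FreeSemigroup.
Variable A : finType.

Definition word : Type := {w : seq A | w != [::]}.

HB.instance Definition _ := SubChoice.on word.

Lemma word_mul_subproof (v w : word) : val v ++ val w != [::].
Proof. by case: v w => [[]]. Qed.

Definition word_mul (v w : word) : word :=
  exist _ (val v ++ val w) (word_mul_subproof v w).

Lemma word_mulA : associative word_mul.
Proof. by move=> u v w; apply: val_inj; rewrite /= catA. Qed.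

HB.instance Definition _ := isSemigroup.Build word word_mulA.
End FreeSemigroup.

Section FreePro.
Variables (V : finSemigroupType -> Prop) (A : finType).

(** The index set of the inverse limit: the congruences of [A^+] whose quotient
    is, up to isomorphism, a finite semigroup in [V]. *)
Record Vcongruence := VCongruence {
  Vcong :> congruence (word A);
  VcongP : exists (S : finSemigroupType)
                  (f : {multiplicative S -> cong_quotient Vcong}), V S /\ bijective f
}.

(** For [theta] contained in [theta'], the transition map of the inverse system
    sends the [theta]-class of a word to its [theta']-class. *)
Record free_pro := FreePro {
  fp_coord :> forall theta : Vcongruence, cong_quotient theta;
  fp_compat : forall theta theta' : Vcongruence,
    (forall x y, theta x y -> theta' x y) ->
    \pi_(cong_quotient theta') (repr (fp_coord theta)) = fp_coord theta'
}.

Lemma free_proP (u v : free_pro) : (forall theta, u theta = v theta) -> u = v.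
Proof.
case: u v => [u uP] [v vP] /= uv; have {}uv : u = v by exact: functional_extensionality_dep.
by subst v; congr FreePro; exact: Prop_irrelevance.
Qed.

HB.instance Definition _ := gen_eqMixin free_pro.
HB.instance Definition _ := gen_choiceMixin free_pro.

Lemma fp_mul_subproof (u v : free_pro) (theta theta' : Vcongruence) :
  (forall x y, theta x y -> theta' x y) ->
  \pi_(cong_quotient theta') (repr (u theta * v theta)) = u theta' * v theta'.
Proof.
move=> le; rewrite -(fp_compat u le) -(fp_compat v le) -pi_quotientM.
by apply/pi_quotientP/le/pi_quotientP; rewrite reprK.
Qed.

Definition fp_mul (u v : free_pro) : free_pro :=
  FreePro (fp_mul_subproof u v).

Lemma fp_mulA : associative fp_mul.
Proof. by move=> u v w; apply: free_proP => theta /=; rewrite mulgA. Qed.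

HB.instance Definition _ := isSemigroup.Build free_pro fp_mulA.

Lemma fp_word_subproof (w : word A) (theta theta' : Vcongruence) :
  (forall x y, theta x y -> theta' x y) ->
  \pi_(cong_quotient theta') (repr (\pi_(cong_quotient theta) w))
    = \pi_(cong_quotient theta') w.
Proof. by move=> le; apply/pi_quotientP/le/pi_quotientP; rewrite reprK. Qed.

Definition fp_word (w : word A) : free_pro := FreePro (fp_word_subproof w).

Lemma fp_wordM : {morph fp_word : v w / v * w}.
Proof. by move=> v w; apply: free_proP => theta /=; rewrite pi_quotientM. Qed.

HB.instance Definition _ :=
  isMultiplicative.Build (word A) free_pro fp_word fp_wordM.

End FreePro.

Section Subshift.
Variable A : finType.
Implicit Types (X : set (int -> A)) (x : int -> A).

Definition shift_seq x : int -> A := fun i => x (i + 1)%R.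

Record is_subshift X : Prop := {
  subshift_nonempty : X !=set0;
  subshift_closed : closed (X : set {ptws int -> discrete_topology A});
  subshift_shift : shift_seq @` X = X
}.

Definition occurs (w : word A) x : Prop :=
  exists k : int, val w = mkseq (fun i => x (k + i%:Z)%R) (size (val w)).

Definition language X : set (word A) :=
  [set w | exists2 x, X x & occurs w x].

Definition least_period x (n : nat) : Prop :=
  [/\ (0 < n)%N, iter n shift_seq x = x
    & forall m, (0 < m)%N -> iter m shift_seq x = x -> (n <= m)%N].

Definition periodic_points X (n : nat) : set (int -> A) :=
  [set x | X x /\ least_period x n].

Lemma iter_shiftE n x i : iter n shift_seq x i = x (i + n%:Z)%R.
Proof.
elim: n x i => [|n IHn] x i; first by rewrite GRing.addr0.
by rewrite iterSr IHn /shift_seq -GRing.addrA -PoszD addn1.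
Qed.

Lemma finite_periodic_points X n : finite_set (periodic_points X n).
Proof.
case: n => [|n]; first by apply: sub_finite_set (finite_set0 _) => x [_ []].
pose g (t : {ffun 'I_n.+1 -> A}) (i : int) := t (inord `|(i %% n.+1)%Z|%N).
apply: (@sub_finite_set _ _ (range g)); last exact/finite_image/finite_finset.
move=> x [_ [_ xP _]]; exists [ffun j : 'I_n.+1 => x (Posz (val j))] => //.
have per (k : nat) i : x (i + Posz (k * n.+1))%R = x i.
  elim: k i => [|k IHk] i; first by rewrite mul0n GRing.addr0.
  by rewrite mulSn PoszD GRing.addrA IHk -iter_shiftE xP.
apply/funext => i; rewrite /g ffunE /= inordK; last first.
  by rewrite -ltz_nat gez0_abs ?ltz_pmod ?modz_ge0.
rewrite gez0_abs ?modz_ge0 //.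
rewrite [in RHS](divz_eq i n.+1) GRing.addrC; case: (divz i n.+1) => k.
  by rewrite -PoszM per.
by rewrite NegzE GRing.mulNr -PoszM -[RHS](per k.+1) GRing.subrK.
Qed.

(** [fset_set] is only meaningful on finite sets, hence the previous lemma. *)
Definition nb_periodic X (n : nat) : nat :=
  #|` fset_set (periodic_points X n) |.

Lemma nb_periodicP X n : (periodic_points X n #= `I_(nb_periodic X n))%card.
Proof.
rewrite -[Y in (Y #= _)%card](fset_setK (finite_periodic_points X n)).
exact/card_eq_fsetP.
Qed.

End Subshift.

Section Mirage.
Variables (V : finSemigroupType -> Prop) (A : finType) (X : set (int -> A)).
Let F := free_pro V A.

Definition mirage : set F :=
  [set u | forall w : word A, is_factor (fp_word V w) u -> language X w].

Definition K_object : set F := [set e | mirage e /\ is_idempotent e].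

(** The arrow [(e, u, f)] goes from [f] to [e]. *)
Definition K_arrow (f e : F) : set (F * F * F) :=
  [set a | exists u, [/\ a = (e, u, f), mirage u & u = e * u * f]].

(** Only meaningful on arrows [(e, u, f)] and [(f, v, g)]. The composites used
    below are identities, so stating isomorphism does not require knowing that
    arrows are closed under composition. *)
Definition K_comp (a b : F * F * F) : F * F * F :=
  (a.1.1, a.1.2 * b.1.2, b.2).

Definition K_id (e : F) : F * F * F := (e, e, e).

Definition K_isomorphic (e f : F) : Prop :=
  exists a b, [/\ K_arrow f e a, K_arrow e f b,
    K_comp a b = K_id e & K_comp b a = K_id f].

Definition K_iso_class (e : F) : set F :=
  [set f | K_object f /\ K_isomorphic e f].

End Mirage.

Arguments mirage V {A} X _.
Arguments K_object V {A} X _.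
Arguments K_arrow V {A} X f e _.
Arguments K_isomorphic V {A} X e f.
Arguments K_iso_class V {A} X e _.

(* Main.v *)
From HB Require Import structures.
Require Import Defs.
From mathcomp Require Import all_boot all_algebra all_classical topology.
From mathcomp Require Import zify.

(** An idempotent [e] of the mirage has a left-infinite suffix and a
    right-infinite prefix; glued together they form a point of the subshift,
    because every window of it is a factor of [e * e = e]. If [e = s * t], then
    [t * e * s] is an idempotent isomorphic to [e] whose point has its origin
    between [s] and [t]. Hence the points of the class of [e] contain the orbit
    of the point of [e], and every finite factor of [e] starts at the origin of
    the point of some member of the class. If the class is finite, all these
    points have a common period, so the finite factors of [e] are periodic; then
    [e] is approximated by words that are powers of a single word, and so is
    determined by its point, the class being in bijection with a periodic orbit.
    Conversely a periodic point with period word [u] is the point of the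
    idempotent power of [u]. *)

Set Implicit Arguments.
Unset Strict Implicit.
Unset Printing Implicit Defensive.

Local Open Scope classical_set_scope.
Local Open Scope group_scope.
Local Open Scope quotient_scope.

(** * Factors of finite words *)

Section Infixes.
Variable T : eqType.
Implicit Types (s t u v w x y a b : seq T).

Lemma take_cat_take k x y : take k (x ++ y) = take k (take k x ++ take k y).
Proof.
rewrite !take_cat size_take; case: (ltnP k (size x)) => [kx|xk].
  by rewrite ltnn subnn take0 cats0.
rewrite ltnNge xk /= [take k x]take_oversize //; congr (_ ++ _).
by rewrite take_takel // leq_subr.
Qed.

Lemma infix_cat_split v x y : infix v (x ++ y) ->
  [\/ infix v x, infix v y | exists v1 v2,
      [/\ v = v1 ++ v2, suffix v1 x & prefix v2 y]].
Proof.
case/infixP => p [q].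
move=> E; case: (leqP (size (p ++ v)) (size x)) => [vx|xv].
  apply: Or31; apply/infixP; exists p, (take (size x - size (p ++ v)) q).
  have := congr1 (take (size x)) E.
  rewrite take_size_cat // catA take_cat ltnNge vx /= => {1}->.
  by rewrite catA.
rewrite size_cat in xv; case: (leqP (size x) (size p)) => [xp|px].
  apply: Or32; apply/infixP; exists (drop (size x) p), q.
  have := congr1 (drop (size x)) E; rewrite drop_size_cat // => {1}->.
  rewrite drop_cat; case: ltnP => // px; have -> : size x = size p by lia.
  by rewrite subnn drop0 drop_oversize.
apply: Or33; exists (take (size x - size p) v), (drop (size x - size p) v).
rewrite cat_take_drop; split=> //.
  apply/suffixP; exists p; have := congr1 (take (size x)) E.
  rewrite take_size_cat // take_cat ltnNge (ltnW px) take_cat /=.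
  by case: ltnP => //; lia.
apply/prefixP; exists q; have := congr1 (drop (size x)) E.
rewrite drop_size_cat // drop_cat ltnNge (ltnW px) drop_cat /=.
by case: ltnP => //; lia.
Qed.

Lemma suffix_catl_le v x y : (size v <= size y)%N -> suffix v (x ++ y) = suffix v y.
Proof.
move=> vy; rewrite !suffixE size_cat drop_cat; case: ltnP => [|_]; first by lia.
by have -> : (size x + size y - size v - size x = size y - size v)%N by lia.
Qed.

Lemma prefix_take_le k v x : (size v <= k)%N -> prefix v (take k x) = prefix v x.
Proof. by move=> vk; rewrite !prefixE take_takel. Qed.

Lemma suffix_take_rev k v x :
  (size v <= k)%N -> suffix v (rev (take k (rev x))) = suffix v x.
Proof. by move=> vk; rewrite -prefix_revLR prefix_take_le ?size_rev // prefix_rev. Qed.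

Lemma suffix_prefix_infix v1 v2 x y :
  suffix v1 x -> prefix v2 y -> infix (v1 ++ v2) (x ++ y).
Proof.
case/suffixP=> p ->; case/prefixP=> q ->; apply/infixP; exists p, q.
by rewrite !catA.
Qed.

(** An occurrence across the junction reaches at most [k] letters to either side, so it only sees
    the end of [x] and the beginning of [y]. This makes local equality compatible with products. *)
Lemma infix_cat_local k v x y : (size v <= k)%N ->
  infix v (x ++ y) =
  [|| infix v x, infix v y | infix v (rev (take k (rev x)) ++ take k y)].
Proof.
move=> vk; apply/idP/idP.
  case/infix_cat_split=> [->|->|[v1 [v2 [E s1 p2]]]]; rewrite ?orbT //.
  apply/or3P/Or33; rewrite E suffix_prefix_infix //.
    by rewrite suffix_take_rev //; move: vk; rewrite E size_cat; lia.
  by rewrite prefix_take_le //; move: vk; rewrite E size_cat; lia.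
case/or3P=> [vx|vy|]; first exact: infix_catr.
  exact: infix_catl.
move=> h; apply: infix_trans h _; apply: suffix_prefix_infix.
  by rewrite suffix_revLR prefix_take.
by rewrite prefix_take.
Qed.

(** A factor no longer than [w] cannot meet both [a] and [b]. The identities defining local
    semilattices rest on this. *)
Lemma infix_catW v a w b : (size v <= size w)%N ->
  infix v (a ++ w ++ b) = infix v (a ++ w) || infix v (w ++ b).
Proof.
move=> vw; apply/idP/orP => [|[h|h]]; last 2 first.
- by rewrite catA infix_catr.
- by rewrite infix_catl.
rewrite catA; case/infix_cat_split=> [->|vb|[v1 [v2 [E s1 p2]]]]; first by left.
  by right; rewrite infix_catl.
right; rewrite E suffix_prefix_infix // -(suffix_catl_le a) //.
by move: vw; rewrite E size_cat; lia.
Qed.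
End Infixes.

(** * Finite quotients and the local testability congruences *)

Section FiniteQuotient.
Variables (S : semigroupType) (theta : congruence S) (T : finType).
Variables (g : cong_quotient theta -> T) (g_inj : injective g).

(** The injectivity proof is an argument of the alias so that the embedding into [T], and with it
    the [Finite] structure, can be recovered from the type. *)
Definition finite_quotient of injective g : Type := cong_quotient theta.
Local Notation Q := (finite_quotient g_inj).

HB.instance Definition _ := Semigroup.on Q.

Definition finite_quotient_inv (t : T) : option Q :=
  if pselect (exists x : Q, g x = t) is left ex then Some (projT1 (cid ex))
  else None.

Lemma finite_quotientK : pcancel (g : Q -> T) finite_quotient_inv.
Proof.
move=> x; rewrite /finite_quotient_inv; case: pselect => [ex|[]]; last by exists x.
by congr Some; apply: g_inj; case: cid.
Qed.

HB.instance Definition _ := PCanIsCountable finite_quotientK.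
HB.instance Definition _ : isFinite Q := PCanIsFinite finite_quotientK.

Definition finite_quotient_val (x : Q) : cong_quotient theta := x.

Lemma finite_quotient_valM : {morph finite_quotient_val : x y / x * y}.
Proof. by []. Qed.

HB.instance Definition _ :=
  isMultiplicative.Build Q (cong_quotient theta) finite_quotient_val
    finite_quotient_valM.
End FiniteQuotient.

Lemma idem_quotientP (S : semigroupType) (theta : congruence S) (x : S) :
  theta (x * x) x <-> is_idempotent (\pi_(cong_quotient theta) x).
Proof.
rewrite /is_idempotent -pi_quotientM; split=> [?|/pi_quotientP//].
exact/pi_quotientP.
Qed.

Section Kernel.
Variables (S : semigroupType) (T : finType) (g : S -> T).
Hypothesis gM : forall x x' y y', g x = g x' -> g y = g y' -> g (x * y) = g (x' * y').

Let r (x y : S) := g x == g y.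

Lemma kernel_equiv : equiv_class_of r.
Proof.
by rewrite /r; split=> [x|x y|y x z /eqP->].

Qed.

Lemma kernel_congM x x' y y' :
  EquivRelPack kernel_equiv x x' -> EquivRelPack kernel_equiv y y' ->
  EquivRelPack kernel_equiv (x * y) (x' * y').
Proof. by move=> /eqP xx' /eqP yy'; apply/eqP/gM. Qed.

Definition kernel : congruence S := Congruence kernel_congM.

Lemma kernelE x y : kernel x y = (g x == g y). Proof. by []. Qed.

Lemma kernel_repr_inj : injective (fun x : cong_quotient kernel => g (repr x)).
Proof.
move=> x y xy; rewrite -(reprK x) -(reprK y).
by apply/pi_quotientP; rewrite kernelE; apply/eqP.
Qed.

Definition kernel_quotient : finSemigroupType := finite_quotient kernel_repr_inj.
End Kernel.

Section VcongruenceOfKernel.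
Variables (V : finSemigroupType -> Prop) (A : finType) (T : finType).
Variable g : word A -> T.
Hypothesis gM : forall x x' y y', g x = g x' -> g y = g y' -> g (x * y) = g (x' * y').
Hypothesis VQ : V (kernel_quotient gM).

Lemma kernel_VcongP : exists (S : finSemigroupType)
  (f : {multiplicative S -> cong_quotient (kernel gM)}), V S /\ bijective f.
Proof.
exists (kernel_quotient gM).
exists (@finite_quotient_val _ _ _ _ (@kernel_repr_inj _ _ _ gM)).
by split=> //; exists id.
Qed.

Definition kernel_Vcong : Vcongruence V A := VCongruence kernel_VcongP.

Lemma kernel_VcongE x y : kernel_Vcong x y = (g x == g y).
Proof. by []. Qed.
End VcongruenceOfKernel.

(** * Congruences given by prefixes, suffixes and factors of bounded length *)

Section LocalTest.
Variables (A : finType) (k : nat).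
Implicit Types x y w : word A.

Lemma size_take_leq (s : seq A) : (size (take k s) <= k)%N.
Proof. by rewrite size_take_min geq_minl. Qed.

(** The values lie in a finite type, so the kernel of this map has a finite quotient without any
    counting. *)
Definition local_data w : (k.-bseq A * k.-bseq A * {set k.-bseq A})%type :=
  (Bseq (size_take_leq (sval w)), Bseq (size_take_leq (rev (sval w))),
   finset (fun v : k.-bseq A => infix v (sval w))).

(** On words of length less than [k] this is equality. *)
Definition local_eq x y : Prop :=
  [/\ take k (sval x) = take k (sval y),
      take k (rev (sval x)) = take k (rev (sval y))
    & forall v, (size v <= k)%N -> infix v (sval x) = infix v (sval y)].

Lemma local_dataP x y : local_data x = local_data y <-> local_eq x y.
Proof.
split=> [E|[E1 E2 E3]].
  split; [exact: (congr1 (fun d => bseqval d.1.1) E)|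
          exact: (congr1 (fun d => bseqval d.1.2) E)|].
  by move=> v vk; have /setP/(_ (Bseq vk)) := congr1 snd E; rewrite !inE.
rewrite /local_data; congr (_, _, _); [exact: val_inj|exact: val_inj|].
by apply/setP => v; rewrite !inE E3 ?size_bseq.
Qed.

Lemma local_dataM x x' y y' : local_data x = local_data x' ->
  local_data y = local_data y' -> local_data (x * y) = local_data (x' * y').
Proof.
move=> /local_dataP[x1 x2 x3] /local_dataP[y1 y2 y3]; apply/local_dataP; split=> /=.
- by rewrite take_cat_take x1 y1 -take_cat_take.
- by rewrite !rev_cat take_cat_take x2 y2 -take_cat_take.
- move=> v vk; rewrite (infix_cat_local _ _ vk) x3 // y3 // x2 y1.
  by rewrite -infix_cat_local.
Qed.

(** If the nonempty word [w] were shorter than [k], squaring it would lengthen its prefix truncated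
    at [k]. *)
Lemma local_idem_size w : local_data (w * w) = local_data w -> (k <= size (sval w))%N.
Proof.
case/local_dataP => /(congr1 size) + _ _; rewrite !size_take_min /= size_cat.
by case: w => [[|a w]] //= _; lia.
Qed.

Lemma local_data_sandwich w x : (k <= size (sval w))%N ->
  local_data (w * x * w * x * w) = local_data (w * x * w).
Proof.
move=> kw; apply/local_dataP; split=> /=.
- by rewrite -!catA !takel_cat.
- by rewrite !rev_cat !takel_cat ?size_rev.
- move=> v vk; rewrite -[in LHS]catA -[in LHS]catA infix_catW ?(leq_trans vk) //.
  by rewrite !catA orbb.
Qed.

(** Both sides begin and end with [w], which covers the prefix and suffix of length [k]. By
    [infix_catW] their factors of length at most [k] are those of [w * x * w] together with those of
    [w * y * w], and this union is symmetric. *)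
Lemma local_data_comm w x y : (k <= size (sval w))%N ->
  local_data (w * x * w * y * w) = local_data (w * y * w * x * w).
Proof.
move=> kw; apply/local_dataP; split=> /=.
- by rewrite -!catA !takel_cat.
- by rewrite !rev_cat !takel_cat ?size_rev.
- move=> v vk; rewrite -[in LHS]catA -[in LHS]catA infix_catW ?(leq_trans vk) //.
  rewrite orbC (catA (sval w) (sval y)) -(catA (sval w) (sval x)).
  by rewrite -infix_catW ?(leq_trans vk) // !catA.
Qed.

(** The representative of an idempotent class has length at least [k], so [local_data_sandwich] and
    [local_data_comm] apply to it. *)
Lemma LSl_local : LSl (kernel_quotient local_dataM).
Proof.
pose Q := cong_quotient (kernel local_dataM).
suff H (e : Q) : e * e = e ->
    (forall s t, e * s * e * (e * t * e) = e * t * e * (e * s * e))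
    /\ (forall s, e * s * e * (e * s * e) = e * s * e).
  move=> e /(H e)[h1 h2]; split=> [x y [s ->] [t ->]|x [s ->]]; first exact: h1.
  exact: h2.
move=> ee.
have pi (a b : word A) : local_data a = local_data b -> \pi_Q a = \pi_Q b.
  by move=> ab; apply/pi_quotientP; rewrite kernelE; apply/eqP.
have kw : (k <= size (sval (repr e)))%N.
  have : kernel local_dataM (repr e * repr e) (repr e).
    by apply/idem_quotientP; rewrite /is_idempotent reprK.
  by rewrite kernelE => /eqP/local_idem_size.
have E (s t : Q) : e * s * e * (e * t * e) = e * s * e * t * e.
  by rewrite !mulgA -(mulgA (e * s)) ee.
have piM3 (a b c : word A) : \pi_Q (a * b * c) = \pi_Q a * \pi_Q b * \pi_Q c.
  by rewrite [LHS]pi_quotientM [in LHS]pi_quotientM.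
move: (repr e) kw (reprK e) => w kw we.
split=> [s t|s]; rewrite !E.
  move: (repr s) (reprK s) (repr t) (reprK t) => a sa b tb.
  have := pi _ _ (local_data_comm a b kw).
  by rewrite !piM3 we sa tb.
move: (repr s) (reprK s) => a sa; have := pi _ _ (local_data_sandwich a kw).
by rewrite !piM3 we sa.
Qed.
End LocalTest.

(** * Limits of words in the free pro-V semigroup *)

Section FreeProLimits.
Variables (V : finSemigroupType -> Prop) (hV : is_pseudovariety V).
Variable A : finType.
Implicit Types (w : word A) (th : Vcongruence V A) (u v : free_pro V A).

Definition refines th th' := forall x y : word A, th x y -> th' x y.

Lemma free_pro_refines u th th' w : refines th th' ->
  u th = \pi_(cong_quotient th) w -> u th' = \pi_(cong_quotient th') w.
Proof.
by move=> le uw; rewrite -(fp_compat u le) uw; exact: (fp_word_subproof w le).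
Qed.

Lemma Vcong_finite th : exists (S : finSemigroupType) (h : word A -> S),
  [/\ V S, {morph h : x y / x * y}
    & forall x y, h x = h y <-> \pi_(cong_quotient th) x = \pi_(cong_quotient th) y].
Proof.
have [S [f [VS [g fK gK]]]] := VcongP th.
exists S, (fun x => g (\pi_(cong_quotient th) x)).
split=> //; first by move=> x y; apply: (can_inj fK); rewrite gmulfM !gK pi_quotientM.
by move=> x y; split=> [/(can_inj gK)//|->].
Qed.

(** The quotient by the intersection embeds in the product of [S1] and [S2], so it belongs to [V].
    The index set of the inverse limit is thus directed. *)
Lemma Vcong_inter th1 th2 : exists th, refines th th1 /\ refines th th2.
Proof.
have [S1 [h1 [VS1 h1M h1P]]] := Vcong_finite th1.
have [S2 [h2 [VS2 h2M h2P]]] := Vcong_finite th2.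
pose S (b : bool) : finSemigroupType := if b then S1 else S2.
pose h (b : bool) w : S b := if b return S b then h1 w else h2 w.
pose g w : {dffun forall b, S b} := finfun (fun b => h b w).
have gM0 x y : g (x * y) = g x * g y.
  by apply/ffunP => -[]; rewrite !ffunE /= ?h1M ?h2M.
have gM x x' y y' : g x = g x' -> g y = g y' -> g (x * y) = g (x' * y').
  by rewrite !gM0 => -> ->.
pose f (x : kernel_quotient gM) := g (repr (x : cong_quotient (kernel gM))).
have fM : {morph f : x y / x * y}.
  move=> x y; rewrite /f -gM0; apply/eqP; rewrite -(kernelE gM).
  by apply/pi_quotientP; rewrite reprK.
pose fm : {multiplicative kernel_quotient gM -> {dffun forall b, S b}} :=
  HB.pack f (isMultiplicative.Build _ _ f fM).
have VQ : V (kernel_quotient gM).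
  apply: (pv_sub hV (f := fm)); first exact: kernel_repr_inj.
  by apply: (pv_prod hV) => -[].
exists (kernel_Vcong VQ).
have gE x y : kernel_Vcong VQ x y -> h1 x = h1 y /\ h2 x = h2 y.
  rewrite kernel_VcongE => /eqP/ffunP gxy.
  by have := gxy true; have := gxy false; rewrite !ffunE.
by split=> x y /gE[e1 e2]; apply/pi_quotientP; [apply/h1P|apply/h2P].
Qed.

(** This replaces the compactness of the free pro-V semigroup: [L p] is the limit
    of [p] along an ultrafilter on the directed set of congruences. *)
Lemma word_limits (th0 : Vcongruence V A) :
  exists L : (Vcongruence V A -> word A) -> free_pro V A,
  [/\ forall p q, L (fun th => p th * q th) = L p * L q,
      forall w, L (fun=> w) = fp_word V w
    & forall u p, (forall th, u th = \pi_(cong_quotient th) (p th)) -> L p = u].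
Proof.
pose F : set_system (Vcongruence V A) :=
  [set P | exists th, forall th', refines th' th -> P th'].
have FF : ProperFilter F.
  split; first by case=> th /(_ th); apply.
  split; first by exists th0.
  - move=> P Q [th1 P1] [th2 Q2]; have [th [r1 r2]] := Vcong_inter th1 th2.
    by exists th => th' r'; split; [apply: P1|apply: Q2] => x y /r';
      [apply: r1|apply: r2].
  - by move=> P Q PQ [th Pth]; exists th => th' /Pth/PQ.
have [U [UU FU]] := ultraFilterLemma FF.
have Ulim (p : Vcongruence V A -> word A) th : exists q : cong_quotient th,
    U [set th' | \pi_(cong_quotient th) (p th') = q].
  have [S [h [_ _ hP]]] := Vcong_finite th.
  (* [h] takes values in a finite set. If no fibre belonged to [U], all complements of fibres would,
     and their finite intersection is empty. *)
  apply: contrapT => noq.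
  have Uh (s : S) : U [set th' | h (p th') <> s].
    have [Us|//] := in_ultra_setVsetC [set th' | h (p th') = s] UU.
    have [th' hs] := filter_ex Us; case: noq; exists (\pi_(cong_quotient th) (p th')).
    by apply: filterS Us => th'' hs''; apply/hP; rewrite hs'' -hs.
  by have [th' /(_ (h (p th')))] := filter_ex (filter_forall _ Uh).
pose l p th := projT1 (cid (Ulim p th)).
have lU p th : U [set th' | \pi_(cong_quotient th) (p th') = l p th].
  by rewrite /l; case: cid.
have lE p th q : U [set th' | \pi_(cong_quotient th) (p th') = q] -> l p th = q.
  by move=> Uq; have [th' [<- <-]] := filter_ex (filterI (lU p th) Uq).
have lP p th th' : refines th th' ->
    \pi_(cong_quotient th') (repr (l p th)) = l p th'.
  move=> le; have [t [<- <-]] := filter_ex (filterI (lU p th) (lU p th')).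
  exact: (fp_word_subproof (p t) le).
exists (fun p => FreePro (lP p)); split.
- move=> p q; apply: free_proP => th /=; apply: lE.
  apply: filterS (filterI (lU p th) (lU q th)) => t [/= <- <-].
  exact: pi_quotientM.
- by move=> w; apply: free_proP => th /=; apply: lE; apply: filterS filterT.
- move=> u p up; apply: free_proP => th /=; apply: lE; apply: FU.
  by exists th => th' le /=; rewrite (free_pro_refines le (up th')).
Qed.

(** Cofactors chosen separately for each congruence need not be compatible. The limit [L],
    multiplicative and faithful to words, turns the family into a single element. *)
Lemma free_pro_prefix (th0 : Vcongruence V A) u w :
  (forall th, exists q, u th = \pi_(cong_quotient th) (w * q)) ->
  exists t, u = fp_word V w * t.
Proof.
have [L [LM Lc Lu]] := word_limits th0; move=> /choice[q uq].
by exists (L q); rewrite -Lc -LM (Lu u).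
Qed.

Lemma free_pro_factor (th0 : Vcongruence V A) u w :
  (forall th, exists p q, u th = \pi_(cong_quotient th) (p * w * q)) ->
  exists s t, u = s * fp_word V w * t.
Proof.
have [L [LM Lc Lu]] := word_limits th0; move=> /choice[p] /choice[q uq].
by exists (L p), (L q); rewrite -Lc -!LM (Lu u).
Qed.
End FreeProLimits.

(** * Two-sided infinite words of idempotents *)

Section PeriodicSequences.
Variable A : Type.
Implicit Types x y : int -> A.

Definition int_periodic x (n : nat) := forall i : int, x (i + n%:Z)%R = x i.

Lemma int_periodicM x n (m : int) i : int_periodic x n -> x (i + m * n%:Z)%R = x i.
Proof.
move=> xn; have P (k : nat) j : x (j + (k * n)%:Z)%R = x j.
  elim: k j => [|k IH] j; first by congr x; lia.
  by rewrite -[RHS](IH j) -[RHS]xn; congr x; lia.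
case: m => k; first by rewrite -PoszM P.
by rewrite -(P k.+1 (i + _)%R); congr x; rewrite NegzE PoszM; lia.
Qed.

Lemma int_periodic_ext x y n (a : int) : (0 < n)%N ->
  int_periodic x n -> int_periodic y n ->
  (forall j, (j < n)%N -> x (a + j%:Z)%R = y (a + j%:Z)%R) -> x = y.
Proof.
move=> n0 xn yn xy; apply/funext => i.
have mod0 : ((i - a) %% n%:Z)%Z = Posz `|((i - a) %% n%:Z)%Z|%N.
  by rewrite gez0_abs // modz_ge0 //; lia.
have E : i = (a + `|((i - a) %% n%:Z)%Z|%N%:Z + ((i - a) %/ n%:Z)%Z * n%:Z)%R.
  by have := divz_eq (i - a)%R n%:Z; rewrite -mod0; lia.
rewrite E !int_periodicM // xy // -ltz_nat -mod0 ltz_pmod //; lia.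
Qed.

Definition segment x n := mkseq (fun i => x (Posz i)) n.

Lemma segmentD x m n : int_periodic x m ->
  segment x (m + n) = segment x m ++ segment x n.
Proof.
move=> xm; rewrite /segment /mkseq iotaD map_cat; congr (_ ++ _).
rewrite add0n -{1}[m]addn0 iotaDl -map_comp; apply: eq_map => i /=.
by rewrite -[RHS]xm; congr x; lia.
Qed.

Lemma int_periodic_mul x n k : int_periodic x n -> int_periodic x (k * n).
Proof. by move=> xn i; rewrite PoszM int_periodicM. Qed.
End PeriodicSequences.

(** * Local approximation of profinite elements by words *)

Section Approximation.
Variables (V : finSemigroupType -> Prop) (hV : is_pseudovariety V).
Hypothesis hLSl : forall S : finSemigroupType, LSl S -> V S.
Variables (A : finType) (a0 : A).
Implicit Types (w z : word A) (th : Vcongruence V A) (u v e f : free_pro V A).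

Lemma word_of_seq (s : seq A) : s != [::] -> exists w : word A, sval w = s.
Proof. by move=> s0; exists (exist _ s s0). Qed.

Definition local_Vcong k : Vcongruence V A := kernel_Vcong (hLSl (@LSl_local A k)).

Definition approx k u w := u (local_Vcong k) = \pi_(cong_quotient (local_Vcong k)) w.

Lemma local_VcongP k w z : local_Vcong k w z <-> local_eq k w z.
Proof. by rewrite kernel_VcongE; split=> [/eqP/local_dataP|/local_dataP/eqP]. Qed.

Lemma approx_local_eq k u w z : approx k u w -> approx k u z -> local_eq k w z.
Proof.
by rewrite /approx => -> wz; apply/local_VcongP/pi_quotientP.
Qed.

Lemma approx_leq j k u w : (j <= k)%N -> approx k u w -> approx j u w.
Proof.
move=> jk; apply: free_pro_refines => x y /local_VcongP[e1 e2 e3].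
apply/local_VcongP; split=> [||v vj]; last by rewrite e3 // (leq_trans vj).
  by rewrite -[in LHS](minn_idPl jk) -[in RHS](minn_idPl jk) !take_min e1.
by rewrite -[in LHS](minn_idPl jk) -[in RHS](minn_idPl jk) !take_min e2.
Qed.

Lemma approxM k u v w z : approx k u w -> approx k v z -> approx k (u * v) (w * z).
Proof. by rewrite /approx /= => -> ->; rewrite pi_quotientM. Qed.

Lemma approx_word k w : approx k (fp_word V w) w.
Proof. by []. Qed.

Lemma approx_ex k th u : exists w, u th = \pi_(cong_quotient th) w /\ approx k u w.
Proof.
have [th' [r1 r2]] := Vcong_inter hV th (local_Vcong k).
exists (repr (u th')); have E : u th' = \pi_(cong_quotient th') (repr (u th')).
  by rewrite reprK.
by split; [exact: free_pro_refines r1 E|exact: free_pro_refines r2 E].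
Qed.

Lemma approx_idem_size k e w : is_idempotent e -> approx k e w ->
  (k <= size (sval w))%N.
Proof.
move=> ee ew; apply: local_idem_size; apply/local_dataP.
by apply: (approx_local_eq (u := e)) => //; rewrite -ee; apply: approxM.
Qed.

(** Replacing the cofactors of [w] by approximating words gives a word containing [w] and locally
    equal to [z]; local equality preserves factors of length at most [k]. *)
Lemma factor_infix k u w z : is_factor (fp_word V w) u -> (size (sval w) <= k)%N ->
  approx k u z -> infix (sval w) (sval z).
Proof.
move=> wu wk uz.
have [y [uy wy]] : exists y, approx k u y /\ infix (sval w) (sval y).
  case: wu => [->|[p ->]|[q ->]|[p [q ->]]].
  - by exists w; split; [exact: approx_word|exact: infix_refl].
  - have [p' [_ pp']] := approx_ex k (local_Vcong k) p; exists (p' * w).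
    by split; [exact: approxM|exact: suffix_infix].
  - have [q' [_ qq']] := approx_ex k (local_Vcong k) q; exists (w * q').
    by split; [exact: approxM|exact: prefix_infix].
  - have [p' [_ pp']] := approx_ex k (local_Vcong k) p.
    have [q' [_ qq']] := approx_ex k (local_Vcong k) q; exists (p' * w * q').
    by split; [do 2![apply: approxM=> //]|rewrite /= -catA infix_infix].
by have [_ _ /(_ _ wk) <-] := approx_local_eq uy uz.
Qed.

(** Writing [e] as [e * e * e] and locating [w] in the middle copy leaves nonempty words on both
    sides, even when [w] sits at an end of that copy. *)
Lemma infix_factor k e w z : is_idempotent e -> approx k e z ->
  (size (sval w) <= k)%N -> infix (sval w) (sval z) ->
  exists s t, e = s * fp_word V w * t.
Proof.
move=> ee ez wk wz; apply: (free_pro_factor hV (local_Vcong 0)) => th.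
have [y [ey yk]] := approx_ex k th e.
have [_ _ /(_ (sval w) wk)] := approx_local_eq ez yk.
rewrite wz => /esym/infixP[p [q yE]].
have y0 : sval y != [::] by case: (y).
have [p' p'E] : exists p' : word A, sval p' = sval y ++ p.
  by apply: word_of_seq; case: (sval y) y0.
have [q' q'E] : exists q' : word A, sval q' = q ++ sval y.
  by apply: word_of_seq; case: q {yE}.
have e3 : e = e * e * e by rewrite !ee.
exists p', q'; rewrite e3 /= ey -!pi_quotientM.
congr (\pi_(_) _); apply: val_inj; move: p'E q'E yE => /= -> -> yE.
by rewrite {2}yE !catA.
Qed.

(** The two-sided infinite word whose left and right halves are the
    left-infinite suffix and the right-infinite prefix of an idempotent; when
    [e] is not idempotent it may contain the junk letter [a0]. *)
Definition idem_point e (i : int) : A :=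
  match i with
  | Posz n => nth a0 (sval (repr (e (local_Vcong n.+1)))) n
  | Negz n => nth a0 (rev (sval (repr (e (local_Vcong n.+1))))) n
  end.

Lemma approx_point k e w i : approx k e w -> (i < k)%N ->
  nth a0 (sval w) i = idem_point e (Posz i) /\
  nth a0 (rev (sval w)) i = idem_point e (Negz i).
Proof.
move=> ew ik; have er : approx i.+1 e (repr (e (local_Vcong i.+1))).
  by rewrite /approx reprK.
have [E1 E2 _] := approx_local_eq (approx_leq ik ew) er.
by split; rewrite /idem_point -[LHS](nth_take _ (ltnSn i)) ?E1 ?E2 nth_take.
Qed.

Lemma point_uniq e x :
  (forall k, exists2 w, approx k e w & forall i, (i < k)%N ->
    nth a0 (sval w) i = x (Posz i) /\ nth a0 (rev (sval w)) i = x (Negz i)) ->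
  idem_point e = x.
Proof.
move=> ex; apply/funext => -[] n; have [w ew /(_ n (ltnSn n))[x1 x2]] := ex n.+1;
  by have [p1 p2] := approx_point ew (ltnSn n); rewrite -?p1 -?p2.
Qed.

Lemma point_window_factor e w (a : int) n : is_idempotent e ->
  sval w = mkseq (fun i => idem_point e (a + i%:Z)%R) n ->
  exists s t, e = s * fp_word V w * t.
Proof.
(* In a square [z * z] approximating [e * e], the junction is the origin of the point. This [k]
   makes both halves long enough to contain the window, which then starts at index [b]. *)
move=> ee wE; pose k := (`|a| + n)%N.
have [z [_ ez]] := approx_ex k (local_Vcong 0) e.
have zk := approx_idem_size ee ez.
apply: (infix_factor (k := k) (z := z * z) ee).
- by rewrite -ee; apply: approxM.
- by rewrite wE size_mkseq leq_addl.
pose b := `|(a + (size (sval z))%:Z)%R|%N.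
have bE : (b%:Z = a + (size (sval z))%:Z)%R by rewrite /b; lia.
apply/infixP; exists (take b (sval z ++ sval z)), (drop (b + n)%N (sval z ++ sval z)).
have -> : sval (z * z) = sval z ++ sval z by [].
rewrite -{1}[_ ++ _](cat_take_drop b); congr (_ ++ _).
rewrite -[drop b _](cat_take_drop n) drop_drop addnC; congr (_ ++ _).
have szt : size (take n (drop b (sval z ++ sval z))) = n.
  by rewrite size_takel // size_drop size_cat; lia.
apply: (@eq_from_nth _ a0); first by rewrite szt wE size_mkseq.
move=> i; rewrite szt => ni; rewrite wE nth_mkseq // nth_take // nth_drop nth_cat.
case: ltnP => bi.
  pose j := (size (sval z) - (b + i).+1)%N; have jk : (j < k)%N by lia.
  have [_] := approx_point ez jk; rewrite nth_rev; last exact: leq_trans jk zk.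
  have -> : (size (sval z) - j.+1 = b + i)%N by rewrite /j; lia.
  by move=> ->; congr (idem_point e); lia.
pose j := (b + i - size (sval z))%N; have jk : (j < k)%N by lia.
have [-> _] := approx_point ez jk.
by congr (idem_point e); lia.
Qed.

(** All finite factors are constrained, not only those visible in the point: an idempotent may have
    factors that occur near neither of its ends. *)
Definition periodic_factors n u := forall w, is_factor (fp_word V w) u ->
  forall i, (i + n < size (sval w))%N -> nth a0 (sval w) i = nth a0 (sval w) (i + n).

Lemma factor_mull w s u : is_factor (fp_word V w) u -> is_factor (fp_word V w) (s * u).
Proof.
case=> [->|[p ->]|[q ->]|[p [q ->]]].
- by apply: Or42; exists s.
- by apply: Or42; exists (s * p); rewrite mulgA.
- by apply: Or44; exists s, q; rewrite mulgA.
- by apply: Or44; exists (s * p), q; rewrite !mulgA.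
Qed.

Lemma factor_mulr w s u : is_factor (fp_word V w) u -> is_factor (fp_word V w) (u * s).
Proof.
case=> [->|[p ->]|[q ->]|[p [q ->]]].
- by apply: Or43; exists s.
- by apply: Or44; exists p, s.
- by apply: Or43; exists (q * s); rewrite mulgA.
- by apply: Or44; exists p, (q * s); rewrite !mulgA.
Qed.

End Approximation.

Arguments idem_point : simpl never.

(** * Idempotents whose finite factors share a period *)

Section PeriodicIdempotents.
Variables (V : finSemigroupType -> Prop) (hV : is_pseudovariety V).
Hypothesis hLSl : forall S : finSemigroupType, LSl S -> V S.
Variables (A : finType) (a0 : A).
Implicit Types (w z : word A) (th : Vcongruence V A) (u v e f : free_pro V A).

Local Notation approx := (approx hLSl).
Local Notation idem_point := (idem_point hLSl a0).
Local Notation periodic_factors := (periodic_factors a0).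

Lemma point_window_is_factor e w (a : int) n : is_idempotent e ->
  sval w = mkseq (fun i => idem_point e (a + i)%R) n -> is_factor (fp_word V w) e.
Proof.
move=> ee wE; have [s [t E]] := point_window_factor hV ee wE.
by apply: Or44; exists s, t.
Qed.

(** Each window of [n.+1] letters of [w] is short enough to be a factor of [e], so the period
    propagates along the whole of [w], however long. *)
Lemma periodic_approx n k e w : is_idempotent e -> periodic_factors n e ->
  (n < k)%N -> approx k e w -> forall i, (i + n < size (sval w))%N ->
  nth a0 (sval w) i = nth a0 (sval w) (i + n).
Proof.
move=> ee en nk ew i iw.
have sz : size (take n.+1 (drop i (sval w))) = n.+1.
  by rewrite size_takel // size_drop; lia.
have [z zE] : exists z : word A, sval z = take n.+1 (drop i (sval w)).
  by apply: word_of_seq; rewrite -size_eq0 sz.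
have zw : infix (sval z) (sval w).
  by rewrite zE; apply: infix_trans (infix_take _ _) (infix_drop _ _).
have zk : (size (sval z) <= k)%N by rewrite zE sz.
have [s [t E]] := infix_factor hV ee ew zk zw.
have ze : is_factor (fp_word V z) e by apply: Or44; exists s, t.
have := en _ ze 0; rewrite add0n zE sz => /(_ (ltnSn n)).
by rewrite !nth_take // !nth_drop addn0.
Qed.

Lemma periodic_point n e : is_idempotent e -> periodic_factors n e ->
  int_periodic (idem_point e) n.
Proof.
move=> ee en i.
have [z zE] : exists z : word A, sval z = mkseq (fun j => idem_point e (i + j)%R) n.+1.
  by apply: word_of_seq; rewrite -size_eq0 size_mkseq.
have := en _ (point_window_is_factor ee zE) 0; rewrite add0n zE size_mkseq.
by move=> /(_ (ltnSn n)); rewrite !nth_mkseq // => <-; congr (idem_point _ _); lia.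
Qed.

Lemma periodic_approx_nth n e w : (0 < n)%N -> is_idempotent e ->
  periodic_factors n e -> approx n.+1 e w ->
  forall i, (i < size (sval w))%N -> nth a0 (sval w) i = idem_point e (Posz i).
Proof.
move=> n0 ee en ew i; elim/ltn_ind: i => i IH iw.
case: (ltnP i n.+1) => [|ni]; first by case/(approx_point a0 ew).
have E : i = (i - n + n)%N by lia.
rewrite [in LHS]E -(periodic_approx ee en (ltnSn n) ew); last by lia.
rewrite IH; [|by lia..]; rewrite -(periodic_point ee en); congr (idem_point _ _); lia.
Qed.

Lemma periodic_approx_segment n e w : (0 < n)%N -> is_idempotent e ->
  periodic_factors n e -> approx n.+1 e w ->
  sval w = segment (idem_point e) (size (sval w)).
Proof.
move=> n0 ee en ew; apply: (@eq_from_nth _ a0); first by rewrite size_mkseq.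
by move=> i iw; rewrite nth_mkseq // (periodic_approx_nth n0 ee en ew).
Qed.

(** The last [n] letters of [w] are read twice: from the left as a continuation of the point from
    its origin, and from the right as the letters just before the origin. Hence translation by the
    length of [w] preserves a full period. *)
Lemma periodic_approx_size n e w : (0 < n)%N -> is_idempotent e ->
  periodic_factors n e -> approx n.+1 e w ->
  int_periodic (idem_point e) (size (sval w)).
Proof.
move=> n0 ee en ew; have xn := periodic_point ee en.
have nw := approx_idem_size ee ew.
suff E : (fun i : int => idem_point e (i + (size (sval w))%:Z)%R) = idem_point e.
  by move=> i; rewrite -[in RHS]E.
apply: (int_periodic_ext (n := n) (a := (- n%:Z)%R)) => //.
  by move=> i; rewrite -[RHS]xn; congr (idem_point _ _); lia.
move=> j jn; have kn : (n - j.+1 < n.+1)%N by lia.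
have [_] := approx_point a0 ew kn; rewrite nth_rev; last by lia.
rewrite (periodic_approx_nth n0 ee en ew); last by lia.
move=> E; transitivity (idem_point e (Negz (n - j.+1))).
  by rewrite -E; congr (idem_point _ _); lia.
by congr (idem_point _ _); lia.
Qed.

Lemma segment_power th (x : int -> A) m w k z : int_periodic x m ->
  sval w = segment x m -> is_idempotent (\pi_(cong_quotient th) w) ->
  sval z = segment x (k.+1 * m) ->
  \pi_(cong_quotient th) z = \pi_(cong_quotient th) w.
Proof.
move=> xm wE ww; elim: k z => [|k IH] z zE.
  by congr (\pi_(_) _); apply: val_inj; rewrite /= zE wE mul1n.
have [y yE] : exists y : word A, sval y = segment x (k.+1 * m).
  apply: word_of_seq; rewrite -size_eq0 size_mkseq muln_eq0 /=.
  rewrite -[m](size_mkseq (fun i => x (Posz i))) -/(segment x m) -wE size_eq0.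
  by case: (w).
rewrite -[RHS]ww -{2}(IH y yE) -pi_quotientM; congr (\pi_(_) _).
by apply: val_inj; rewrite /= zE wE yE mulSn segmentD.
Qed.

(** The segment of length [m * m'] is a power of [w] and also of [w'], and an idempotent equals all
    its powers. *)
Lemma segment_idem_eq th (x : int -> A) m m' w w' :
  int_periodic x m -> int_periodic x m' ->
  sval w = segment x m -> sval w' = segment x m' ->
  is_idempotent (\pi_(cong_quotient th) w) ->
  is_idempotent (\pi_(cong_quotient th) w') ->
  \pi_(cong_quotient th) w = \pi_(cong_quotient th) w'.
Proof.
have size_gt0 (y : word A) n : sval y = segment x n -> (0 < n)%N.
  move=> yE; rewrite -(size_mkseq (fun i => x (Posz i)) n) -/(segment x n) -yE.
  by rewrite lt0n size_eq0; case: (y).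
move=> xm xm' wE w'E ww ww'; have m0 := size_gt0 _ _ wE; have m0' := size_gt0 _ _ w'E.
have [z zE] : exists z : word A, sval z = segment x (m * m').
  by apply: word_of_seq; rewrite -size_eq0 size_mkseq muln_eq0; lia.
rewrite -(segment_power (k := m.-1) (z := z) xm' w'E ww') ?prednK //.
by apply/esym/(segment_power (k := m'.-1) xm wE ww); rewrite prednK // mulnC.
Qed.

Lemma idem_coord e th : is_idempotent e -> is_idempotent (e th).
Proof.
move=> ee.
by rewrite /is_idempotent -[RHS](congr1 (fun u : free_pro V A => u th) ee).
Qed.

(** In each quotient both idempotents are represented by segments of the same point whose lengths
    are periods of it; [segment_idem_eq] identifies them. *)
Lemma periodic_idem_eq n n' e e' : (0 < n)%N -> (0 < n')%N ->
  is_idempotent e -> is_idempotent e' ->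
  periodic_factors n e -> periodic_factors n' e' ->
  idem_point e = idem_point e' -> e = e'.
Proof.
move=> n0 n0' ee ee' en en' pe; apply: free_proP => th.
have [w [ew aw]] := approx_ex hV hLSl n.+1 th e.
have [w' [ew' aw']] := approx_ex hV hLSl n'.+1 th e'.
have wE := periodic_approx_segment n0 ee en aw.
have wE' := periodic_approx_segment n0' ee' en' aw'.
have wP := periodic_approx_size n0 ee en aw.
have wP' := periodic_approx_size n0' ee' en' aw'.
rewrite -pe in wE' wP'; rewrite ew ew'.
by apply: (segment_idem_eq wP wP' wE wE'); rewrite -?ew -?ew'; apply: idem_coord.
Qed.

Lemma segment_idem_exists th (x : int -> A) n : (0 < n)%N -> int_periodic x n ->
  exists m w, sval w = segment x (m.+1 * n) /\ is_idempotent (\pi_(cong_quotient th) w).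
Proof.
move=> n0 xn; have [S [h [_ hM hP]]] := Vcong_finite th.
have /choice[c cE] : forall j, exists w : word A, sval w = segment x (j.+1 * n).
  by move=> j; apply: word_of_seq; rewrite -size_eq0 size_mkseq muln_eq0; lia.
have cM i j : c i * c j = c (i + j).+1.
  apply: val_inj; rewrite /= !cE -segmentD; last exact: int_periodic_mul.
  by congr segment; lia.
have [i [d [d0 hcd]]] : exists i d, (0 < d)%N /\ h (c i) = h (c (i + d)%N).
  have /injectivePn[i [j ij hij]] : ~~ injectiveb (fun i : 'I_#|S|.+1 => h (c i)).
    by apply/injectiveP => /leq_card; rewrite card_ord ltnn.
  have [lij|lij|/val_inj/eqP] := ltngtP i j; last by rewrite (negPf ij).
    by exists i, (j - i)%N; rewrite subn_gt0 lij subnKC // ltnW.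
  by exists j, (i - j)%N; rewrite subn_gt0 lij subnKC // ltnW.
have hc m : (i <= m)%N -> h (c m) = h (c (m + d)%N).
  rewrite leq_eqVlt => /predU1P[<-//|im].
  have -> : m = (i + (m - i).-1).+1 by lia.
  have -> : ((i + (m - i).-1).+1 + d)%N = ((i + d) + (m - i).-1).+1 by lia.
  by rewrite -!cM !hM hcd.
have hcr m r : (i <= m)%N -> h (c m) = h (c (m + r * d)%N).
  move=> im; elim: r => [|r ->]; first by rewrite addn0.
  by rewrite hc; [congr (h (c _)); lia|lia].
(* [c j] is the power of exponent [j.+1] of the period word. The exponent [i.+1 * d] lies past the
   preperiod and is a multiple of [d], so squaring does not change the image under [h]. *)
exists ((i.+1 * d).-1)%N, (c (i.+1 * d).-1); split=> //.
rewrite /is_idempotent -pi_quotientM; apply/hP; rewrite cM [RHS](hcr _ i.+1); last by nia.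
by congr (h (c _)); nia.
Qed.

(** The exponent varies with the quotient, yet the chosen powers are compatible because
    [segment_idem_eq] makes idempotent segments of one point agree. The result is the idempotent
    power of the period word. *)
Lemma omega_power_exists (x : int -> A) n : (0 < n)%N -> int_periodic x n ->
  exists e, is_idempotent e /\ forall th, exists m w,
    sval w = segment x (m.+1 * n) /\ e th = \pi_(cong_quotient th) w.
Proof.
move=> n0 xn.
have /choice[m /choice[w wE]] := fun th => segment_idem_exists th n0 xn.
have compat th th' : (forall y z, th y z -> th' y z) ->
    \pi_(cong_quotient th') (repr (\pi_(cong_quotient th) (w th)))
    = \pi_(cong_quotient th') (w th').
  move=> le; rewrite (fp_word_subproof (w th) le).
  have [[E1 i1] [E2 i2]] := (wE th, wE th').
  apply: segment_idem_eq E1 E2 _ i2; [exact: int_periodic_mul..|].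
  apply/idem_quotientP/le/pi_quotientP.
  by rewrite pi_quotientM.
exists (FreePro compat); split; last by move=> th; exists (m th), (w th); case: (wE th).
by apply: free_proP => th /=; case: (wE th).
Qed.

Lemma periodic_idem_exists (x : int -> A) n : (0 < n)%N -> int_periodic x n ->
  exists e, [/\ is_idempotent e, idem_point e = x, periodic_factors n e
    & forall w, is_factor (fp_word V w) e -> occurs w x].
Proof.
move=> n0 xn; have [e [ee eE]] := omega_power_exists n0 xn; exists e.
have occ w : is_factor (fp_word V w) e -> occurs w x.
  move=> we; have [m [z [zE ez]]] := eE (local_Vcong hLSl A (size (sval w))).
  have := factor_infix hV we (leqnn _) ez; rewrite zE => /infixP[p [q E]].
  exists (Posz (size p)) => /=; apply: (@eq_from_nth _ a0); first by rewrite size_mkseq.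
  move=> i iw; rewrite nth_mkseq //.
  have := congr1 (fun s => nth a0 s (size p + i)) E.
  have : (size p + i < m.+1 * n)%N.
    have := congr1 size E; rewrite size_mkseq !size_cat => ->.
    by rewrite ltn_add2l ltn_addr.
  move=> pi; rewrite nth_mkseq // !nth_cat ltnNge leq_addr /= addKn iw => <-.
  by congr x; lia.
split=> //; last first.
  move=> w /occ[k /= ->] i; rewrite size_mkseq => iw; rewrite !nth_mkseq //; last by lia.
  by rewrite -xn; congr x; lia.
apply: point_uniq => k; have [m [z [zE ez]]] := eE (local_Vcong hLSl A k).
exists z => // i ik; have kz := approx_idem_size ee ez.
have kn : (k <= m.+1 * n)%N by move: kz; rewrite zE size_mkseq.
rewrite zE nth_rev size_mkseq; last by lia.
rewrite !nth_mkseq; [|by lia..]; split=> //.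
(* Counted from the right, letter [i] of [z] has index [m.+1 * n - i.+1], which is [Negz i] up to a
   multiple of the period. *)
by rewrite -((int_periodic_mul m.+1 xn (Negz i))); congr x; lia.
Qed.
End PeriodicIdempotents.

(** * Subshifts and the category of the mirage *)

Section Subshifts.
Variables (A : finType) (X : set (int -> A)) (hX : is_subshift X).
Implicit Types x y : int -> A.

Lemma subshift_shift_by (k : int) x : X x -> X (fun i => x (i + k)%R).
Proof.
have up (n : nat) y : X y -> X (fun i => y (i + n%:Z)%R).
  elim: n y => [|n IH] y Xy.
    by rewrite (_ : (fun _ => _) = y) //; apply/funext => i; congr y; lia.
  rewrite -(subshift_shift hX); exists (fun i => y (i + n%:Z)%R); first exact: IH.
  by apply/funext => i; congr y; lia.
have down (n : nat) y : X y -> X (fun i => y (i - n%:Z)%R).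
  elim: n y => [|n IH] y Xy.
    by rewrite (_ : (fun _ => _) = y) //; apply/funext => i; congr y; lia.
  have := IH _ Xy; rewrite -[in X in X _ -> _](subshift_shift hX) => -[z Xz zE].
  rewrite (_ : (fun _ => _) = z) //; apply/funext => i.
  have := congr1 (fun f => f (i - 1)%R) zE; rewrite /shift_seq.
  rewrite (_ : (i - 1 + 1)%R = i); last by lia.
  by move=> ->; congr y; lia.
case: k => n Xx; first exact: up.
by have := down n.+1 _ Xx; congr X; apply/funext => i; congr x; lia.
Qed.

Lemma subshift_limit x :
  (forall k : nat, exists y, X y /\ forall i : int, (`|i| <= k)%N -> y i = x i) ->
  X x.
Proof.
move=> /choice[y yP].
have Xy : \forall k \near \oo, X (y k) by apply: nearW => k; case: (yP k).
apply: (@closed_cvg nat {ptws int -> discrete_topology A} \oo _ y X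
  (subshift_closed hX) Xy x).
apply/cvg_sup => i; apply/cvg_image.
  by apply/seteqP; split=> a _ //; exists (fun=> a).
move=> W /= /nbhs_singleton Wx; exists ((fun f : int -> A => f i) @^-1` W).
  exists `|i|%N => // k /= ik; have [_ ->//] := yP k.
by apply/seteqP; split=> [_ [f Wf <-]//|a Wa]; exists (fun=> a).
Qed.
End Subshifts.

(** * Isomorphism classes of objects and their points *)

Section MirageCategory.
Variables (V : finSemigroupType -> Prop) (hV : is_pseudovariety V).
Hypothesis hLSl : forall S : finSemigroupType, LSl S -> V S.
Variables (A : finType) (a0 : A).
Variables (X : set (int -> A)) (hX : is_subshift X).
Implicit Types (w z : word A) (th : Vcongruence V A) (u v e f g : free_pro V A).

Local Notation approx := (approx hLSl).
Local Notation idem_point := (idem_point hLSl a0).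
Local Notation periodic_factors := (periodic_factors a0).
Local Notation K_object := (K_object V X).
Local Notation K_isomorphic := (K_isomorphic V X).
Local Notation K_iso_class := (K_iso_class V X).

Lemma mirage_factor u v p q : mirage V X u -> u = p * v * q -> mirage V X v.
Proof. by move=> + E w wv; apply; rewrite E; apply/factor_mulr/factor_mull. Qed.

(** Cutting [u] and [v] down to [e * u] and [f * v] gives the two arrows. These are factors of [e],
    so they lie in the mirage, and isomorphism reduces to conjugacy. *)
Lemma K_isoP e f : K_object e -> is_idempotent f ->
  K_isomorphic e f <-> exists u v, u * v = e /\ v * u = f.
Proof.
move=> [me ee] ff; split=> [[a [b [[u [-> _ _]] [v [-> _ _]]]]]|[u [v [uv vu]]]].
  by rewrite /K_comp /K_id /= => -[uv] [vu]; exists u, v.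
have eu : e * u = u * f by rewrite -uv -vu mulgA.
have ve : v * e = f * v by rewrite -uv -vu mulgA.
have uv' : e * u * (f * v) = e by rewrite mulgA -(mulgA e) -eu mulgA ee -mulgA uv ee.
have vu' : f * v * (e * u) = f by rewrite mulgA -(mulgA f) ve mulgA ff -mulgA vu ff.
exists (e, e * u, f), (f, f * v, e); split.
- exists (e * u); split=> //; last by rewrite mulgA ee -mulgA -eu mulgA ee.
  by apply: (mirage_factor me (p := e) (q := f * v)); rewrite -mulgA uv' ee.
- exists (f * v); split=> //; last by rewrite mulgA ff -mulgA ve mulgA ff.
  by apply: (mirage_factor me (p := e * u) (q := e)); rewrite uv' ee.
- by rewrite /K_comp /= uv'.
- by rewrite /K_comp /= vu'.
Qed.

Lemma K_iso_class_trans e f g : K_object e -> K_iso_class e f ->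
  K_iso_class f g -> K_iso_class e g.
Proof.
move=> Ke [Kf ef] [Kg fg]; split=> //; have [ee ff gg] := And3 Ke.2 Kf.2 Kg.2.
have /(K_isoP Ke ff)[u [v [uv vu]]] := ef.
have /(K_isoP Kf gg)[u' [v' [uv' vu']]] := fg.
apply/(K_isoP Ke gg); exists (u * u'), (v' * v); split.
  by rewrite mulgA -(mulgA u) uv' -vu mulgA uv -mulgA uv ee.
by rewrite mulgA -(mulgA v') vu -uv' mulgA vu' -mulgA vu' gg.
Qed.

Lemma K_iso_class_refl e : K_object e -> K_iso_class e e.
Proof.
by move=> Ke; split=> //; apply/(K_isoP Ke Ke.2); exists e, e; split; exact: Ke.2.
Qed.

Lemma K_conjugate e s t : K_object e -> e = s * t -> K_iso_class e (t * e * s).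
Proof.
move=> Ke E; have [me ee] := Ke.
have ff : is_idempotent (t * e * s).
  by rewrite /is_idempotent !mulgA -(mulgA _ s t) -E -!(mulgA t) !ee.
split; last first.
  by apply/(K_isoP Ke ff); exists s, (t * e); rewrite mulgA -E ee.
split=> //; apply: (mirage_factor me (p := s) (q := t)).
by rewrite !mulgA -E ee -mulgA -E ee.
Qed.

Lemma K_iso_factor e f w : K_object e -> K_iso_class e f ->
  is_factor (fp_word V w) f <-> is_factor (fp_word V w) e.
Proof.
move=> Ke [Kf ef]; have [ee ff] := (Ke.2, Kf.2).
have /(K_isoP Ke ff)[u [v [uv vu]]] := ef.
have -> : e = u * f * v by rewrite -vu mulgA uv -mulgA uv ee.
split; first by move=> ?; apply/factor_mulr/factor_mull.
have {2}-> : f = v * (u * f * v) * u by rewrite !mulgA vu ff -mulgA vu ff.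
by move=> ?; apply/factor_mulr/factor_mull.
Qed.

(** If [e = a * t] with [a] its first letter, the conjugate [t * e * a] carries [a] from the front
    to the back, which moves the origin one step to the right. *)
Lemma K_iso_shift e : K_object e ->
  exists2 f, K_iso_class e f & idem_point f = shift_seq (idem_point e).
Proof.
move=> Ke; have [me ee] := Ke.
pose a : word A := exist (fun s : seq A => s != [::]) [:: idem_point e (Posz 0)] isT.
have [t E] : exists t, e = fp_word V a * t.
  apply: (free_pro_prefix hV (local_Vcong hLSl A 0)) => th.
  have [w [ew aw]] := approx_ex hV hLSl 1 th e.
  have [a1 _] := approx_point a0 aw (ltnSn 0).
  have w0 : sval w != [::] by case: (w).
  have [q qE] : exists q : word A, sval q = behead (sval w) ++ sval w.
    by apply: word_of_seq; case: (sval w) w0 => // ? s _; case: s.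
  exists q; rewrite -ee /= ew -pi_quotientM; congr (\pi_(_) _); apply: val_inj.
  by rewrite /= qE -a1; case: (sval w) w0.
exists (t * e * fp_word V a); first exact: K_conjugate.
apply: point_uniq => k.
(* Depth [k.+1] is taken because removing [a] from the front of [a * z] costs one letter. *)
have [z [_ tz]] := approx_ex hV hLSl k.+1 (local_Vcong hLSl A 0) t.
have ez : approx k.+1 e (a * z) by rewrite E; apply: approxM.
have zk : (k <= size (sval z))%N by have := approx_idem_size ee ez.
exists (z * (a * z) * a).
  by do 2?[apply: approxM]=> //; apply: approx_leq ez || apply: approx_leq tz.
move=> i ik; have [p1 _] := approx_point a0 ez (ik : (i.+1 < k.+1)%N).
have [_ p2] := approx_point a0 ez (leqW ik).
split.
  rewrite /shift_seq [RHS](_ : _ = idem_point e (Posz i.+1)); last first.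
    by congr (idem_point _ _); lia.
  by rewrite -p1 /= -catA nth_cat (leq_trans ik).
(* Left of the new origin, the last letter [a] is the letter at the old origin, and every earlier
   letter moves by one index. *)
case: i ik p1 p2 => [|i] ik p1 p2.
  by rewrite /= rev_cat.
have [_ p3] := approx_point a0 ez (leqW (ltnW ik)).
rewrite [RHS](_ : _ = idem_point e (Negz i)); last by congr (idem_point _ _); lia.
by rewrite -p3 /= !rev_cat /= nth_cat size_rev (leq_trans (ltnW ik) (leqW zk)).
Qed.

Lemma K_iso_shift_iter e f j : K_object e -> K_iso_class e f ->
  exists2 g, K_iso_class e g & idem_point g = iter j (@shift_seq A) (idem_point f).
Proof.
move=> Ke ef; elim: j => [|j [g eg gE]]; first by exists f.
have [h gh hE] := K_iso_shift eg.1.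
by exists h; [exact: K_iso_class_trans Ke eg gh|rewrite hE gE].
Qed.

(** From [e = s * w * t] one obtains the conjugate [w * t * e * s], which begins with [w]. *)
Lemma K_iso_factor_start e w : K_object e -> is_factor (fp_word V w) e ->
  exists2 f, K_iso_class e f
    & forall i, (i < size (sval w))%N -> idem_point f (Posz i) = nth a0 (sval w) i.
Proof.
move=> Ke we; have [me ee] := Ke.
have [s [t E]] : exists s t, e = s * fp_word V w * t.
  case: we => [E|[p E]|[q E]|[p [q E]]].
  - by exists e, e; rewrite -E !ee.
  - by exists p, e; rewrite -E ee.
  - by exists e, q; rewrite -mulgA -E ee.
  - by exists p, q.
exists (fp_word V w * t * e * s); first by apply: K_conjugate => //; rewrite mulgA.
move=> i iw.
have [z [_ wz]] := approx_ex hV hLSl (size (sval w)) (local_Vcong hLSl A 0) (t * e * s).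
have fz : approx (size (sval w)) (fp_word V w * t * e * s) (w * z).
  by rewrite -!mulgA; apply: approxM; rewrite // mulgA.
by have [<- _] := approx_point a0 fz iw; rewrite /= nth_cat iw.
Qed.

Lemma K_object_point e : K_object e -> X (idem_point e).
Proof.
move=> [me ee]; apply: (subshift_limit hX) => k.
have [w wE] : exists w : word A,
    sval w = mkseq (fun i => idem_point e (- k%:Z + i)%R) (k + k).+1.
  by apply: word_of_seq; rewrite -size_eq0 size_mkseq.
have [x Xx [l]] := me w (point_window_is_factor hV ee wE).
move=> /= /esym lE.
(* The window starts at [- k] in the point of [e] and at [l] in [x], whence the translation by
   [l + k]. *)
exists (fun i => x (i + (l + k%:Z))%R); split; first exact: (subshift_shift_by hX _ Xx).
move=> i ik; have := congr1 (fun s => nth a0 s `|(i + k%:Z)%R|%N) lE.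
have sw : size (sval w) = (k + k).+1 by rewrite wE size_mkseq.
rewrite sw wE !nth_mkseq; [|lia..].
move=> E; transitivity (x (l + `|(i + k%:Z)%R|%N%:Z)%R); first by congr x; lia.
by rewrite E; congr (idem_point _ _); lia.
Qed.

Lemma iter_shift_periodic (x : int -> A) n :
  iter n (@shift_seq A) x = x <-> int_periodic x n.
Proof.
split=> [xn i|xn]; first by rewrite -iter_shiftE xn.
by apply/funext => i; rewrite iter_shiftE.
Qed.

Lemma iter_shift_inj i j (x : int -> A) : (i <= j)%N ->
  iter i (@shift_seq A) x = iter j (@shift_seq A) x -> iter (j - i) (@shift_seq A) x = x.
Proof.
move=> ij E; apply/funext => l; have := congr1 (fun y => y (l - i%:Z)%R) E.
by rewrite !iter_shiftE; rewrite GRing.subrK => ->; congr x; lia.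
Qed.

Lemma finite_class_periodic e : K_object e -> finite_set (K_iso_class e) ->
  exists2 n, (0 < n)%N & periodic_factors n e.
Proof.
move=> Ke fin.
have per f : K_iso_class e f -> exists2 d, (0 < d)%N & int_periodic (idem_point f) d.
  (* A point that is not periodic has an infinite forward orbit, yet this orbit consists of points
     of the finite class. *)
  move=> ef; apply: contrapT => nper; apply: infinite_nat.
  have inj : {in [set: nat] &, injective (fun j => iter j (@shift_seq A) (idem_point f))}.
    have lt_neq i j : (i < j)%N ->
        iter i (@shift_seq A) (idem_point f) <> iter j (@shift_seq A) (idem_point f).
      move=> ij /(iter_shift_inj (ltnW ij)) /iter_shift_periodic H; apply: nper.
      by exists (j - i)%N; rewrite // subn_gt0.
    by move=> i j _ _ E; case: (ltngtP i j) => // /lt_neq; rewrite E.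
  rewrite -(eq_finite_set (inj_card_eq inj)).
  apply: sub_finite_set (finite_image idem_point fin) => _ [j _ <-].
  by have [g eg gE] := K_iso_shift_iter j Ke ef; exists g.
have [n n0 nP] : exists2 n, (0 < n)%N
    & forall f, K_iso_class e f -> int_periodic (idem_point f) n.
  have /finite_seqP[s sE] := fin.
  have {}per f : f \in s -> exists2 d, (0 < d)%N & int_periodic (idem_point f) d.
    by move=> fs; apply: per; rewrite sE.
  suff [n n0 nP] : exists2 n, (0 < n)%N
      & forall f, f \in s -> int_periodic (idem_point f) n.
    by exists n => // f; rewrite sE => /nP.
  elim: s per {sE} => [|f s IH] per; first by exists 1%N.
  have [n n0 nP] := IH (fun g gs => per g (@mem_behead _ (f :: s) g gs)).
  have [d d0 dP] := per f (mem_head _ _).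
  exists (n * d)%N; first by rewrite muln_gt0 n0.
  move=> g; rewrite inE => /predU1P[->|/nP gn]; first exact: int_periodic_mul.
  by rewrite mulnC; apply: int_periodic_mul.
exists n => // w we i iw.
have [f ef fE] := K_iso_factor_start Ke we.
by rewrite -!fE; [rewrite -(nP f ef); congr (idem_point _ _); lia|lia..].
Qed.

Lemma class_factors n e f : K_object e -> periodic_factors n e ->
  K_iso_class e f -> periodic_factors n f.
Proof. by move=> Ke en ef w /(K_iso_factor _ Ke ef); apply: en. Qed.

(** A window of length [n] of the point of [f] is a factor of [e], hence occurs in a word read along
    the point of [e]. The index [size p] of the occurrence is the required shift. *)
Lemma class_point_orbit n e f : (0 < n)%N -> K_object e -> periodic_factors n e ->
  K_iso_class e f -> exists j, idem_point f = iter j (@shift_seq A) (idem_point e).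
Proof.
move=> n0 Ke en ef; have fn := class_factors Ke en ef.
have [ee ff] := (Ke.2, ef.1.2).
have [w wE] : exists w : word A, sval w = mkseq (fun i => idem_point f (0 + i%:Z)%R) n.
  by apply: word_of_seq; rewrite -size_eq0 size_mkseq; lia.
have we : is_factor (fp_word V w) e.
  by apply/(K_iso_factor _ Ke ef)/(point_window_is_factor hV ff wE).
have [z [_ ez]] := approx_ex hV hLSl n.+1 (local_Vcong hLSl A 0) e.
have wn : (size (sval w) <= n.+1)%N by rewrite wE size_mkseq.
have /infixP[p [q zE]] := factor_infix hV we wn ez.
exists (size p).
have en' := periodic_point hV hLSl ee en; have fn' := periodic_point hV hLSl ff fn.
apply: (int_periodic_ext (n := n) (a := 0%R)) => //.
  by move=> i; rewrite !iter_shiftE -[RHS]en'; congr (idem_point _ _); lia.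
move=> j jn; rewrite iter_shiftE.
have sz : (size p + j < size (sval z))%N.
  by rewrite zE !size_cat ltn_add2l ltn_addr // wE size_mkseq.
rewrite [RHS](_ : _ = idem_point e (Posz (size p + j))); last first.
  by congr (idem_point _ _); lia.
rewrite -(periodic_approx_nth hV n0 ee en ez sz) zE !nth_cat.
by rewrite ltnNge leq_addr /= addKn wE size_mkseq jn nth_mkseq.
Qed.

(** On the class, [idem_point] is injective by [periodic_idem_eq], and its image is the orbit of the
    point of [e], which has as many elements as the least period. *)
Lemma class_card n e : (0 < n)%N -> K_object e -> periodic_factors n e ->
  exists2 p, least_period (idem_point e) p & (K_iso_class e #= `I_p)%card.
Proof.
move=> n0 Ke en; have ee := Ke.2; pose x := idem_point e.
have xn : int_periodic x n := periodic_point hV hLSl ee en.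
pose P m := `[< (0 < m)%N /\ iter m (@shift_seq A) x = x >].
have exP : exists m, P m.
  by exists n; apply/asboolP; split; last exact/iter_shift_periodic.
case: (ex_minnP exP) => p /asboolP[p0 xp] pmin.
have xper : int_periodic x p by apply/iter_shift_periodic.
have lp : least_period x p.
  by split=> // m m0 xm; apply: pmin; apply/asboolP.
exists p => //; pose g j := iter j (@shift_seq A) x.
have img : idem_point @` K_iso_class e = g @` `I_p.
  apply/seteqP; split=> [_ [f ef <-]|_ [j _ <-]].
    have [j ->] := class_point_orbit n0 Ke en ef.
    exists (j %% p)%N; first by rewrite /= ltn_mod.
    apply/funext => i; rewrite /g !iter_shiftE.
    rewrite -(int_periodicM (Posz (j %/ p)) (i + (j %% p)%N%:Z)%R xper).
    by rewrite /x; congr (idem_point _ _); rewrite [in RHS](divn_eq j p); lia.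
  by have [f ef fE] := K_iso_shift_iter j Ke (K_iso_class_refl Ke); exists f.
have inj1 : {in K_iso_class e &, injective idem_point}.
  move=> f f' /set_mem ef /set_mem ef'.
  have [fn fn'] := (class_factors Ke en ef, class_factors Ke en ef').
  exact: (periodic_idem_eq hV n0 n0 ef.1.2 ef'.1.2 fn fn').
have inj2 : {in `I_p &, injective g}.
  have lt_neq i j : (i < j)%N -> (j < p)%N -> g i <> g j.
    move=> ij jp /(iter_shift_inj (ltnW ij)) E.
    by have [_ _ /(_ (j - i)%N)] := lp; rewrite subn_gt0 ij => /(_ isT E); lia.
  move=> i j /set_mem /= ip /set_mem /= jp E.
  by case: (ltngtP i j) => // /lt_neq H; [case: (H jp)|case: (H ip)].
have := inj_card_eq inj1; rewrite img card_eq_sym => /card_eq_trans; apply.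
exact: inj_card_eq.
Qed.

(** The bijection is [idem_point]: a finite class forces periodic factors, and then [class_card]
    identifies its cardinality with the least period of the point. *)
Lemma card_periodic_points n : (0 < n)%N ->
  ([set e | K_object e /\ K_iso_class e #= `I_n] #= periodic_points X n)%card.
Proof.
move=> n0; set E := [set e | _].
have EP e : E e -> [/\ K_object e, least_period (idem_point e) n
    & exists2 d, (0 < d)%N & periodic_factors d e].
  move=> [Ke ecard]; have fin : finite_set (K_iso_class e) by exists n.
  have [d d0 ed] := finite_class_periodic Ke fin.
  have [p lp pcard] := class_card d0 Ke ed.
  have -> : n = p by apply/card_eq_II; rewrite -(card_eql ecard).
  by split=> //; exists d.
have inj : {in E &, injective idem_point}.
  move=> e f /set_mem/EP[Ke _ [d d0 ed]] /set_mem/EP[Kf _ [d' d0' fd]].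
  exact: (periodic_idem_eq hV d0 d0' Ke.2 Kf.2 ed fd).
suff <- : idem_point @` E = periodic_points X n by rewrite card_eq_sym inj_card_eq.
apply/seteqP; split=> [_ [e /EP[Ke lp _] <-]|x [Xx lp]].
  by split=> //; exact: K_object_point.
have [_ /iter_shift_periodic xn lmin] := lp.
(* Surjectivity: the idempotent power of a period word of [x] has only factors occurring in [x], so
   it is an object. *)
have [e [ee ex en ef]] := periodic_idem_exists hV hLSl a0 n0 xn.
have Ke : K_object e by split=> // w /ef wx; exists x.
exists e => //; split=> //; have [p [p0 xp pmin] pcard] := class_card n0 Ke en.
suff -> : n = p by [].
apply/eqP; rewrite eqn_leq pmin ?lmin //; first by rewrite -ex.
by rewrite ex; exact/iter_shift_periodic.
Qed.
End MirageCategory.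

Local Open Scope card_scope.

Theorem corollary7p9 (A : finType) (hA : (0 < #|A|)%N)
    (X : set (int -> A)) (hX : is_subshift X)
    (V : finSemigroupType -> Prop) (hV : is_pseudovariety V)
    (hLSl : forall S : finSemigroupType, LSl S -> V S)
    (n : nat) (hn : (0 < n)%N) :
  [set e | K_object V X e /\ K_iso_class V X e #= `I_n]
    #= `I_(nb_periodic X n).
Proof.
(* Any letter serves as the default value for [nth] and [idem_point]. *)
have /card_gt0P[a0 _] := hA.
apply: card_eq_trans (nb_periodicP X n).
exact: (card_periodic_points hV hLSl a0 hX hn).
Qed.
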